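(* Let $(k,X,\Omega,\mathcal{A},\mathrm{K})$ be an instance, $\epsilon\in(0,\tfrac12]$, $\delta\in[1,\infty)$, let $(\tilde X,\tilde\Omega)$ be an $(\epsilon/3,\delta)$-coreset for it with extension $f$, let $\tilde C\in\mathcal{C}_\mathrm{K}(k,\tilde X,\tilde\Omega)$ and $\gamma\in\mathbb{R}$ with $\gamma\ge\delta$. (a) If $S$ is a set of $k$ sites and $\operatorname{cost}_{\mathcal{A},\mathrm{K}}(\tilde X,\tilde C,S)\le\gamma\operatorname{cost}_{\mathcal{A},\mathrm{K}}(\tilde X,S)$, then $\operatorname{cost}_{\mathcal{A},\mathrm{K}}(X,f(\tilde C),S)\le(1+\epsilon)\gamma\operatorname{cost}_{\mathcal{A},\mathrm{K}}(X,S)$. (b) If $\operatorname{cost}_{\mathcal{A},\mathrm{K}}(\tilde X,\tilde C)\le\gamma\operatorname{OPT}_{\mathcal{A},\mathrm{K}}(\tilde X)$, then $\operatorname{cost}_{\mathcal{A},\mathrm{K}}(X,f(\tilde C))\le(1+\epsilon)\gamma\operatorname{OPT}_{\mathcal{A},\mathrm{K}}(X)$.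
   Context: Weighted data set $(X,\Omega)$: points $x_1,\dots,x_n\in\mathbb{R}^d$, weights $\omega_j>0$. A $k$-clustering is $C=(\xi_{ij})$, $\xi_{ij}\ge0$, $\sum_i\xi_{ij}=1$; $\mathrm{K}=\{\kappa_i^-,\kappa_i^+\}_{i\le k}$ weight bounds; $\mathcal{C}_\mathrm{K}(k,X,\Omega)$ the (nonempty) set of clusterings with $\kappa_i^-\le\sum_j\xi_{ij}\omega_j\le\kappa_i^+$. $\mathcal{A}=\{A_1,\dots,A_k\}$ symmetric positive definite; $\|y\|_A^2=y^\top Ay$. For sites $S=\{s_1,\dots,s_k\}$: $\operatorname{cost}_{\mathcal{A},\mathrm{K}}(X,C,S)=\sum_{i,j}\xi_{ij}\omega_j\|x_j-s_i\|_{A_i}^2$; $\operatorname{cost}_{\mathcal{A},\mathrm{K}}(X,S)=\min_{C\in\mathcal{C}_\mathrm{K}}\operatorname{cost}_{\mathcal{A},\mathrm{K}}(X,C,S)$; $\operatorname{cost}_{\mathcal{A},\mathrm{K}}(X,C)=\min_S\operatorname{cost}_{\mathcal{A},\mathrm{K}}(X,C,S)$; $\operatorname{OPT}_{\mathcal{A},\mathrm{K}}(X)=\min_{C\in\mathcal{C}_\mathrm{K}}\operatorname{cost}_{\mathcal{A},\mathrm{K}}(X,C)$. Coreset: for $\epsilon'\in(0,\tfrac12]$, $\delta\ge1$, $(\tilde X,\tilde\Omega)$ is an $(\epsilon',\delta)$-coreset if there are a map (extension) $f:\mathcal{C}_\mathrm{K}(k,\tilde X,\tilde\Omega)\to\mathcal{C}_\mathrm{K}(k,X,\Omega)$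 and reals $0\le\Delta^+\le\delta\Delta^-$ such that for all sets $S$ of $k$ sites and all $\tilde C$: $(1-\epsilon')\operatorname{cost}_{\mathcal{A},\mathrm{K}}(X,f(\tilde C),S)\le\operatorname{cost}_{\mathcal{A},\mathrm{K}}(\tilde X,\tilde C,S)+\Delta^+$ and $\operatorname{cost}_{\mathcal{A},\mathrm{K}}(\tilde X,S)+\Delta^-\le(1+\epsilon')\operatorname{cost}_{\mathcal{A},\mathrm{K}}(X,S)$. *)

(* Defs.v *)
From HB Require Import structures.
From mathcomp Require Import all_boot all_order all_algebra.
From mathcomp Require Import all_classical all_reals all_analysis.

Set Implicit Arguments.
Unset Strict Implicit.
Unset Printing Implicit Defensive.

Import Order.TTheory GRing.Theory Num.Theory.
Import numFieldNormedType.Exports.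
Local Open Scope classical_set_scope.
Local Open Scope ring_scope.

Record dataset (R : realType) (d n : nat) := Dataset {
  pt : 'I_n -> 'cV[R]_d;
  wt : 'I_n -> R;
  wt_gt0 : forall j, 0 < wt j }.

Definition sqnormA (R : realType) (d : nat) (A : 'M[R]_d) (y : 'cV[R]_d) : R :=
  (y^T *m A *m y) 0 0.

Definition sympd (R : realType) (d : nat) (A : 'M[R]_d) : Prop :=
  A^T = A /\ forall y : 'cV[R]_d, y != 0 -> 0 < sqnormA A y.

Definition clusterings (R : realType) (d n k : nat) (D : dataset R d n)
    (lo hi : 'I_k -> R) : set 'M[R]_(k, n) :=
  [set C | [/\ forall i j, 0 <= C i j,
               forall j, \sum_i C i j = 1
             & forall i, lo i <= \sum_j C i j * wt D j <= hi i]].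

Definition instance (R : realType) (d n k : nat) (D : dataset R d n)
    (A : 'I_k -> 'M[R]_d) (lo hi : 'I_k -> R) : Prop :=
  (forall i, sympd (A i)) /\ clusterings D lo hi !=set0.

Definition cost (R : realType) (d n k : nat) (D : dataset R d n)
    (A : 'I_k -> 'M[R]_d) (C : 'M[R]_(k, n)) (S : 'I_k -> 'cV[R]_d) : R :=
  \sum_i \sum_j C i j * wt D j * sqnormA (A i) (pt D j - S i).

(* A "set of k sites" is a family indexed by 'I_k: coinciding sites are
   allowed, as they can be forced at an optimum.
   The three minima below are written with [inf]; the lemmas at the end of
   the file show that for an instance each of them is attained. *)
Definition cost_sites (R : realType) (d n k : nat) (D : dataset R d n)
    (A : 'I_k -> 'M[R]_d) (lo hi : 'I_k -> R) (S : 'I_k -> 'cV[R]_d) : R :=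
  inf [set cost D A C S | C in clusterings D lo hi].

Definition cost_clustering (R : realType) (d n k : nat) (D : dataset R d n)
    (A : 'I_k -> 'M[R]_d) (C : 'M[R]_(k, n)) : R :=
  inf [set cost D A C S | S in [set: 'I_k -> 'cV[R]_d]].

Definition opt (R : realType) (d n k : nat) (D : dataset R d n)
    (A : 'I_k -> 'M[R]_d) (lo hi : 'I_k -> R) : R :=
  inf [set cost_clustering D A C | C in clusterings D lo hi].

(* Only the values of [f] on [clusterings D' lo hi] are constrained, so [f]
   represents a map between the two sets of clusterings. *)
Definition coreset_with_extension (R : realType) (d n n' k : nat)
    (D : dataset R d n) (A : 'I_k -> 'M[R]_d) (lo hi : 'I_k -> R)
    (D' : dataset R d n') (eps delta : R)
    (f : 'M[R]_(k, n') -> 'M[R]_(k, n)) : Prop :=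
  set_fun (clusterings D' lo hi) (clusterings D lo hi) f /\
  exists Dplus Dminus : R,
    [/\ 0 <= Dplus, Dplus <= delta * Dminus
      & forall (S : 'I_k -> 'cV[R]_d) (C' : 'M[R]_(k, n')),
          clusterings D' lo hi C' ->
          (1 - eps) * cost D A (f C') S <= cost D' A C' S + Dplus /\
          cost_sites D' A lo hi S + Dminus
            <= (1 + eps) * cost_sites D A lo hi S].

Lemma inf_min (R : realType) (E : set R) (m : R) :
  E m -> lbound E m -> inf E = m.
Proof.
move=> Em lm; apply/eqP; rewrite eq_le; apply/andP; split.
  by apply: ge_inf => //; exists m.
by apply: lb_le_inf => //; exists m.
Qed.

Lemma sqnormA_ge0 (R : realType) (d : nat) (A : 'M[R]_d) (y : 'cV[R]_d) :
  sympd A -> 0 <= sqnormA A y.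
Proof.
move=> [_ pA]; have [->|y0] := eqVneq y 0; last exact/ltW/pA.
by rewrite /sqnormA mulmx0 mxE.
Qed.

Definition centroid (R : realType) (d n k : nat) (D : dataset R d n)
    (C : 'M[R]_(k, n)) (i : 'I_k) : 'cV[R]_d :=
  (\sum_j C i j * wt D j)^-1 *: \sum_j (C i j * wt D j) *: pt D j.

Lemma cost_centroid_le (R : realType) (d n k : nat) (D : dataset R d n)
    (A : 'I_k -> 'M[R]_d) (C : 'M[R]_(k, n)) (S : 'I_k -> 'cV[R]_d) :
  (forall i, sympd (A i)) -> (forall i j, 0 <= C i j) ->
  cost D A C (centroid D C) <= cost D A C S.
Proof.
move=> pA C0; apply: ler_sum => i _.
set c := centroid D C i; set B := A i; pose w j := C i j * wt D j.
have w0 j : 0 <= w j by rewrite mulr_ge0 // ltW // wt_gt0.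
have sw : \sum_j w j *: (pt D j - c) = 0.
  under eq_bigr do rewrite scalerBr.
  rewrite sumrB -scaler_suml /c /centroid -/w scalerA.
  have [W0|W0] := eqVneq (\sum_j w j) 0; last by rewrite mulfV // scale1r subrr.
  rewrite W0 mul0r scale0r subr0 big1 // => j _.
  have /allP : all (fun j => true ==> (w j == 0)) (index_enum 'I_n).
    by rewrite -psumr_eq0 // W0.
  by move=> /(_ j); rewrite mem_index_enum /= => /(_ isT) /eqP ->; rewrite scale0r.
have E j : sqnormA B (pt D j - S i) =
    sqnormA B (pt D j - c) + ((c - S i)^T *m B *m (pt D j - c)) 0 0
    + ((pt D j - c)^T *m (B *m (c - S i))) 0 0 + sqnormA B (c - S i).
  have -> : pt D j - S i = (pt D j - c) + (c - S i) by rewrite addrA subrK.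
  move: (pt D j - c) (c - S i) => u v.
  rewrite /sqnormA [X in X *m B]linearD /= mulmxDr !mulmxDl !mulmxA.
  rewrite [LHS]mxE [X in X + _]mxE [X in _ + X]mxE.
  by rewrite !addrA.
under [X in _ <= X]eq_bigr do rewrite -/(w _) E !mulrDr.
rewrite !big_split /=.
have -> : \sum_j w j * ((c - S i)^T *m B *m (pt D j - c)) 0 0 = 0.
  transitivity (((c - S i)^T *m B *m \sum_j w j *: (pt D j - c)) 0 0).
    rewrite mulmx_sumr summxE; apply: eq_bigr => j _.
    by rewrite -scalemxAr [RHS]mxE.
  by rewrite sw mulmx0 mxE.
have -> : \sum_j w j * ((pt D j - c)^T *m (B *m (c - S i))) 0 0 = 0.
  transitivity (((\sum_j w j *: (pt D j - c))^T *m (B *m (c - S i))) 0 0).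
    rewrite linear_sum /= mulmx_suml summxE; apply: eq_bigr => j _.
    have -> : (w j *: (pt D j - c))^T = w j *: (pt D j - c)^T.
      exact: linearZ.
    by rewrite -scalemxAl [RHS]mxE.
  by rewrite sw trmx0 mul0mx mxE.
rewrite !addr0 lerDl; apply: sumr_ge0 => j _.
by apply: mulr_ge0 => //; apply: sqnormA_ge0; exact: pA.
Qed.

Lemma centroid_bound (R : realType) (d n k : nat) (D : dataset R d n)
    (C : 'M[R]_(k, n)) (i : 'I_k) (r : 'I_d) : (forall i j, 0 <= C i j) ->
  `|centroid D C i r 0| <= \sum_j \sum_s `|pt D j s 0|.
Proof.
move=> C0; pose w j := C i j * wt D j.
have w0 j : 0 <= w j by rewrite mulr_ge0 // ltW // wt_gt0.
rewrite /centroid -/w mxE summxE mulr_sumr.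
apply: le_trans (ler_norm_sum _ _ _) _; apply: ler_sum => j _.
rewrite mxE mulrA normrM.
apply: (@le_trans _ _ `|pt D j r 0|); last first.
  by rewrite (bigD1 r) //= lerDl sumr_ge0.
apply: ler_piMl => //.
rewrite ger0_norm; last first.
  apply: mulr_ge0; last exact: w0.
  by rewrite invr_ge0; apply: sumr_ge0 => l _; exact: w0.
have [->|W0] := eqVneq (\sum_j w j) 0; first by rewrite invr0 mul0r.
rewrite mulrC ler_pdivrMr ?mul1r.
  rewrite [leRHS](bigD1 j) //= lerDl.
  by apply: sumr_ge0 => l _; exact: w0.
by rewrite lt_def W0; apply: sumr_ge0 => l _; exact: w0.
Qed.

Lemma cost_box_min (R : realType) (d n k : nat) (D : dataset R d n)
    (A : 'I_k -> 'M[R]_d) (lo hi : 'I_k -> R) (a b : 'I_k -> 'cV[R]_d) :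
  clusterings D lo hi !=set0 -> (forall i r, a i r 0 <= b i r 0) ->
  exists C0 (S0 : 'I_k -> 'cV[R]_d), [/\ clusterings D lo hi C0,
    forall i r, a i r 0 <= S0 i r 0 <= b i r 0 &
    forall C (S : 'I_k -> 'cV[R]_d), clusterings D lo hi C ->
      (forall i r, a i r 0 <= S i r 0 <= b i r 0) ->
      cost D A C0 S0 <= cost D A C S].
Proof.
move=> [C1 C1P] ab.
pose c (v : 'rV[R]_(k * n + k * d)) : 'M[R]_(k, n) := vec_mx (lsubmx v).
pose s (v : 'rV[R]_(k * n + k * d)) i : 'cV[R]_d :=
  (row i (vec_mx (rsubmx v)))^T.
pose e (C : 'M[R]_(k, n)) (S : 'I_k -> 'cV[R]_d) : 'rV[R]_(k * n + k * d) :=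
  row_mx (mxvec C) (mxvec (\matrix_(i, r) S i r 0)).
have ce C S : c (e C S) = C by rewrite /c /e row_mxKl mxvecK.
have se C S i : s (e C S) i = S i.
  rewrite /s /e row_mxKr mxvecK; apply/matrixP => r z.
  by rewrite (ord1 z) !mxE.
have cE v i j : c v i j = v 0 (lshift _ (mxvec_index i j)) by rewrite /c !mxE.
have sE v i r : s v i r 0 = v 0 (rshift _ (mxvec_index i r)) by rewrite /s !mxE.
have cc i j : continuous (fun v => c v i j).
  under eq_fun do rewrite cE; exact: coord_continuous.
have sc i r : continuous (fun v => s v i r 0).
  under eq_fun do rewrite sE; exact: coord_continuous.
pose K := [set v | clusterings D lo hi (c v) /\
                   forall i r, a i r 0 <= s v i r 0 <= b i r 0].
have sum_cont (T : topologicalType) (I : finType) (g : I -> T -> R) :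
    (forall i, continuous (g i)) -> continuous (fun v => \sum_i g i v).
  move=> gc v; elim: (index_enum I) => [|i r IH].
    by under eq_fun do rewrite big_nil; exact: cvg_cst.
  under eq_fun do rewrite big_cons.
  by apply: cvgD; [exact: gc|exact: IH].
have mul_cont (T : topologicalType) (g h : T -> R) :
    continuous g -> continuous h -> continuous (fun v => g v * h v).
  by move=> gc hc v; apply: cvgM; [exact: gc|exact: hc].
have clle (g : 'rV[R]_(k * n + k * d) -> R) x y : continuous g ->
    closed [set v | x <= g v <= y].
  move=> gc; rewrite (_ : mkset _ = [set v | x <= g v] `&` [set v | g v <= y]).
    apply: closedI.
      by apply: (preimage_closed _ (@closed_ge _ x)) => v _; exact: gc.
    by apply: (preimage_closed _ (@closed_le _ y)) => v _; exact: gc.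
  by apply/seteqP; split => v /= => [/andP[]//|[-> ->]].
have clall (I : Type) (g : I -> set 'rV[R]_(k * n + k * d)) :
    (forall i, closed (g i)) -> closed [set v | forall i, g i v].
  move=> gc; rewrite (_ : mkset _ = \bigcap_(i in setT) g i).
    by apply: closed_bigI => i _; exact: gc.
  by apply/seteqP; split => v /= h i => [_|]; exact: h.
have Kcl : closed K.
  rewrite (_ : K = [set v | forall i j, 0 <= c v i j <= 1] `&`
      ([set v | forall j, 1 <= \sum_i c v i j <= 1] `&`
      ([set v | forall i, lo i <= \sum_j c v i j * wt D j <= hi i] `&`
       [set v | forall i r, a i r 0 <= s v i r 0 <= b i r 0]))).
    apply: closedI; first by apply: (@clall _) => i; apply: (@clall _) => j; exact: clle.
    apply: closedI.
      by apply: (@clall _) => j; apply: (@clle _); apply: (@sum_cont _ _) => i; exact: cc.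
    apply: closedI.
      apply: (@clall _) => i; apply: (@clle _); apply: (@sum_cont _ _) => j.
      by apply: (@mul_cont _); [exact: cc|exact: cst_continuous].
    by apply: (@clall _) => i; apply: (@clall _) => j; exact: clle.
  apply/seteqP; split => v /= => [[[h1 h2 h3] h4]|[h1 [h2 [h3 h4]]]].
    split=> [i j|]; last by split=> [j|]; [rewrite h2 lexx|].
    by rewrite h1 -(h2 j) (bigD1 i) //= lerDl sumr_ge0.
  split=> //; split=> // [i j|j]; first by case/andP: (h1 i j).
  by apply/eqP; rewrite eq_le andbC; exact: h2.
have Kco : compact K.
  pose z (i : 'I_(k * n + k * d)) : set R :=
    match fintype.split i with
    | inl _ => `[0, 1]%classic
    | inr _ => `[e 0 a 0 i, e 0 b 0 i]%classic
    end.
  have zc i : compact (z i) by rewrite /z;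
    case: fintype.split => ?; exact: segment_compact.
  apply: subclosed_compact Kcl (rV_compact zc) _ => v [[h1 h2 h3] h4] i.
  rewrite /z -(splitK i); case: (fintype.split i) => q; rewrite unsplitK /= in_itv /=.
    case/mxvec_indexP: q => i' j; rewrite -cE h1 -(h2 j) (bigD1 i') //=.
    by rewrite lerDl sumr_ge0.
  case/mxvec_indexP: q => i' r; rewrite !row_mxEr !mxvecE !mxE -sE.
  exact: h4.
have [|||v vK vmin] := @EVT_min_rV R _ (fun v => cost D A (c v) (s v)) K.
- exists (e C1 a); rewrite /K /= ce; split=> // i r.
  by rewrite se lexx ab.
- exact: Kco.
- apply: continuous_subspaceT; apply: (@sum_cont _ _) => i; apply: (@sum_cont _ _) => j.
  apply: (@mul_cont _).
    by apply: (@mul_cont _); [exact: cc|exact: cst_continuous].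
  rewrite /sqnormA.
  under eq_fun do (rewrite mxE; under eq_bigr do rewrite mxE mulr_suml).
  apply: (@sum_cont _ _) => i0; apply: (@sum_cont _ _) => i1.
  have sub_cont r : continuous (fun v => (pt D j - s v i) r 0).
    under eq_fun do rewrite mxE [X in _ + X]mxE.
    move=> v.
    apply: (@continuousB _ _ _ (fun=> pt D j r 0) (fun v => s v i r 0)) => //.
      exact: cst_continuous.
    exact: sc.
  under eq_fun do rewrite [_^T _ _]mxE.
  apply: (@mul_cont _) => //.
  by apply: (@mul_cont _) => //; exact: cst_continuous.
exists (c v), (s v); move: vK; rewrite inE => -[vC vS]; split=> // C S hC hS.
have -> : cost D A C S = cost D A (c (e C S)) (s (e C S)).
  by rewrite ce; congr cost; apply/funext => i; rewrite se.
apply: vmin; rewrite inE /K /= ce; split=> // i r; rewrite se; exact: hS.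
Qed.

Lemma cost_sites_attained (R : realType) (d n k : nat) (D : dataset R d n)
    (A : 'I_k -> 'M[R]_d) (lo hi : 'I_k -> R) (S : 'I_k -> 'cV[R]_d) :
  clusterings D lo hi !=set0 ->
  exists2 C, clusterings D lo hi C & cost_sites D A lo hi S = cost D A C S.
Proof.
move=> ne; have [//|i r|C0 [S0 [C0P S0P C0min]]] :=
  @cost_box_min R d n k D A lo hi S S; first exact: lexx.
have S0E : S0 = S.
  apply/funext => i; apply/matrixP => r z; rewrite (ord1 z).
  by apply/eqP; rewrite eq_le andbC; exact: S0P.
exists C0 => //; apply: inf_min; first by exists C0.
move=> _ [C CP <-]; rewrite -{1}S0E; apply: C0min => // i r.
by rewrite lexx.
Qed.

Lemma cost_clustering_attained (R : realType) (d n k : nat)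
    (D : dataset R d n) (A : 'I_k -> 'M[R]_d) (lo hi : 'I_k -> R)
    (C : 'M[R]_(k, n)) :
  (forall i, sympd (A i)) -> clusterings D lo hi C ->
  cost_clustering D A C = cost D A C (centroid D C).
Proof.
move=> pA [C0 _ _]; apply: inf_min; first by exists (centroid D C).
by move=> _ [S _ <-]; exact: cost_centroid_le.
Qed.

Lemma opt_attained (R : realType) (d n k : nat) (D : dataset R d n)
    (A : 'I_k -> 'M[R]_d) (lo hi : 'I_k -> R) :
  instance D A lo hi ->
  exists2 C, clusterings D lo hi C & opt D A lo hi = cost_clustering D A C.
Proof.
move=> [pA ne]; pose M := \sum_j \sum_s `|pt D j s 0|.
have M0 : 0 <= M by apply: sumr_ge0 => j _; apply: sumr_ge0.
have [//|i r|C0 [S0 [C0P _ C0min]]] :=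
  @cost_box_min R d n k D A lo hi (fun=> const_mx (- M)) (fun=> const_mx M).
  by rewrite !mxE ge0_cp.
exists C0 => //; apply: inf_min; first by exists C0.
move=> _ [C CP <-]; rewrite !(cost_clustering_attained pA CP).
rewrite (cost_clustering_attained pA C0P).
have /= [C0p _ _] := C0P.
apply: le_trans (cost_centroid_le D S0 pA C0p) _.
apply: C0min => // i r.
have cstE x : (const_mx x : 'cV[R]_d) r 0 = x by rewrite mxE.
rewrite !cstE -ler_norml.
by apply: centroid_bound; case: CP.
Qed.

(* Main.v *)
(* Since 0 <= Delta^+ <= delta * Delta^- and delta <= gamma, the additive error
   Delta^+ is at most gamma * Delta^-, so it can be absorbed:
     (1 - eps/3) cost(X, f C', S) <= cost(X', C', S) + Delta^+
                                  <= gamma (cost(X', S) + Delta^-)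
                                  <= gamma (1 + eps/3) cost(X, S),
   and 1 + eps/3 <= (1 - eps/3)(1 + eps).  For the second claim the left
   coreset inequality is applied at the centroids of C', the right one at the
   sites of an optimum for X. *)
Require Import Defs.
From HB Require Import structures.
From mathcomp Require Import all_boot all_order all_algebra.
From mathcomp Require Import all_classical all_reals all_analysis.
From mathcomp Require Import lra.
Import Order.TTheory GRing.Theory Num.Theory.
Import numFieldNormedType.Exports.
Local Open Scope classical_set_scope.
Local Open Scope ring_scope.

Lemma cost_ge0 {R : realType} {d n k : nat} (D : dataset R d n)
    (A : 'I_k -> 'M[R]_d) (C : 'M[R]_(k, n)) (S : 'I_k -> 'cV[R]_d) :
  (forall i, sympd (A i)) -> (forall i j, 0 <= C i j) -> 0 <= cost D A C S.
Proof.
move=> pA C0; apply: sumr_ge0 => i _; apply: sumr_ge0 => j _.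
by rewrite mulr_ge0 ?sqnormA_ge0// mulr_ge0// ltW// wt_gt0.
Qed.

Lemma cost_sites_le {R : realType} {d n k : nat} {D : dataset R d n}
    {A : 'I_k -> 'M[R]_d} {lo hi : 'I_k -> R} {C : 'M[R]_(k, n)}
    (S : 'I_k -> 'cV[R]_d) :
  (forall i, sympd (A i)) -> clusterings D lo hi C ->
  cost_sites D A lo hi S <= cost D A C S.
Proof.
move=> pA CP; apply: ge_inf; last by exists C.
by exists 0 => _ [B [B0 _ _] <-]; exact: cost_ge0.
Qed.

Lemma cost_sites_ge0 {R : realType} {d n k : nat} {D : dataset R d n}
    {A : 'I_k -> 'M[R]_d} {lo hi : 'I_k -> R} (S : 'I_k -> 'cV[R]_d) :
  instance D A lo hi -> 0 <= cost_sites D A lo hi S.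
Proof.
by move=> [pA /(cost_sites_attained A S)[C [C0 _ _] ->]]; exact: cost_ge0.
Qed.

Lemma cost_clustering_le {R : realType} {d n k : nat} {D : dataset R d n}
    {A : 'I_k -> 'M[R]_d} {lo hi : 'I_k -> R} {C : 'M[R]_(k, n)}
    (S : 'I_k -> 'cV[R]_d) :
  (forall i, sympd (A i)) -> clusterings D lo hi C ->
  cost_clustering D A C <= cost D A C S.
Proof.
move=> pA CP; rewrite (cost_clustering_attained pA CP).
by case: CP => C0 _ _; exact: cost_centroid_le.
Qed.

(** A clustering attaining [cost_sites] at [S] can only get cheaper when its sites are optimized
    too. *)
Lemma opt_le_cost_sites {R : realType} {d n k : nat} {D : dataset R d n}
    {A : 'I_k -> 'M[R]_d} {lo hi : 'I_k -> R} (S : 'I_k -> 'cV[R]_d) :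
  instance D A lo hi -> opt D A lo hi <= cost_sites D A lo hi S.
Proof.
move=> [pA /(cost_sites_attained A S)[C CP ->]].
apply: le_trans (cost_clustering_le S pA CP); apply: ge_inf; last by exists C.
exists 0 => _ [B BP <-]; rewrite (cost_clustering_attained pA BP).
by case: BP => B0 _ _; exact: cost_ge0.
Qed.

(** The centroids of an optimal clustering serve as [S]. *)
Lemma opt_eq_cost_sites {R : realType} {d n k : nat} {D : dataset R d n}
    {A : 'I_k -> 'M[R]_d} {lo hi : 'I_k -> R} :
  instance D A lo hi -> exists S, opt D A lo hi = cost_sites D A lo hi S.
Proof.
move=> inst; have [C CP oC] := opt_attained inst; have [pA _] := inst.
exists (centroid D C); apply/eqP; rewrite eq_le opt_le_cost_sites//=.
by rewrite oC (cost_clustering_attained pA CP) cost_sites_le.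
Qed.

(** Arithmetic common to both claims: [m'] is [cost_sites] of [D'] in the first and [opt] of [D'] in
    the second. *)
Lemma approx_transfer {R : realFieldType}
    (eps delta gamma Dp Dm c c' m m' : R) :
  0 < eps <= 1 / 2 -> 1 <= delta -> delta <= gamma ->
  0 <= Dp -> Dp <= delta * Dm -> 0 <= m ->
  (1 - eps / 3) * c <= c' + Dp -> c' <= gamma * m' ->
  m' + Dm <= (1 + eps / 3) * m ->
  c <= (1 + eps) * gamma * m.
Proof.
move=> /andP[e0 e1] d1 dg Dp0 DpDm m0 hc hc' hm.
(* The sign of [Dm] comes from [0 <= Dp <= delta * Dm] with [delta] positive; it allows replacing
   [delta] by [gamma]. *)
have Dm0 : 0 <= Dm.
  by rewrite -(@pmulr_rge0 _ delta) ?(le_trans Dp0)// (lt_le_trans ltr01).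
have g0 : 0 <= gamma by exact: le_trans ler01 (le_trans d1 dg).
have DpgDm : Dp <= gamma * Dm by apply: le_trans DpDm _; exact: ler_wpM2r.
have ub : gamma * (m' + Dm) <= gamma * ((1 + eps / 3) * m) by exact: ler_wpM2l.
have e3 : 0 < 1 - eps / 3 by lra.
(* The sides differ by [eps * (1 - eps) / 3]; the bound on [eps * eps] makes this linear. *)
have factor : 1 + eps / 3 <= (1 - eps / 3) * (1 + eps).
  have : eps * eps <= eps * (1 / 2) by rewrite ler_pM2l.
  lra.
have gm0 : 0 <= gamma * m by exact: mulr_ge0.
have scaled := ler_wpM2r gm0 factor.
by rewrite -(ler_pM2l e3); lra.
Qed.

Theorem theorem3p5 (R : realType) (d n n' k : nat)
    (D : dataset R d n) (A : 'I_k -> 'M[R]_d) (lo hi : 'I_k -> R)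
    (eps delta : R) (D' : dataset R d n')
    (f : 'M[R]_(k, n') -> 'M[R]_(k, n))
    (C' : 'M[R]_(k, n')) (gamma : R) :
  instance D A lo hi ->
  0 < eps <= 1 / 2 ->
  1 <= delta ->
  coreset_with_extension D A lo hi D' (eps / 3) delta f ->
  clusterings D' lo hi C' ->
  delta <= gamma ->
  (forall S : 'I_k -> 'cV[R]_d,
     cost D' A C' S <= gamma * cost_sites D' A lo hi S ->
     cost D A (f C') S <= (1 + eps) * gamma * cost_sites D A lo hi S) /\
  (cost_clustering D' A C' <= gamma * opt D' A lo hi ->
   cost_clustering D A (f C') <= (1 + eps) * gamma * opt D A lo hi).
Proof.
move=> inst eps12 delta1 [fP [Dp [Dm [Dp0 DpDm cs]]]] C'P dg.
have [pA _] := inst.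
have inst' : instance D' A lo hi by split=> //; exists C'.
split=> [S aS|aC].
  have [lower upper] := cs S C' C'P.
  exact: approx_transfer eps12 delta1 dg Dp0 DpDm (cost_sites_ge0 S inst)
    lower aS upper.
have [S oS] := opt_eq_cost_sites inst; rewrite oS.
(* Using different sites in the two inequalities is sound because [Dp] and [Dm] are uniform in the
   sites. *)
have [lower _] := cs (centroid D' C') C' C'P.
have [_ upper] := cs S C' C'P.
rewrite -(cost_clustering_attained pA C'P) in lower.
apply: le_trans (cost_clustering_le (centroid D' C') pA (fP _ C'P)) _.
apply: approx_transfer eps12 delta1 dg Dp0 DpDm (cost_sites_ge0 S inst)
  lower aC _.
(* [upper] concerns [cost_sites] of [D'] at [S], which dominates [opt] of [D']. *)
by apply: le_trans upper; rewrite lerD2r; exact: opt_le_cost_sites.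
Qed.
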